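(* Let $X$ be a Hausdorff space, let $\tau^c$ be the family of all closed subsets of $X$ and $\mathcal C_X$ the family of all compact subsets of $X$. Let $Y$ be a Hausdorff space with a strictly increasing closed cover $\{B_n\}_{n\in\mathbb N}$. For a map $\phi:\tau^c\to\mathcal L(X,\mathcal F(Y))$, $F\mapsto\phi_F$ (with $\phi_x:=\phi_{\{x\}}$ for $x\in X$), consider the properties: (i) for each $F\in\tau^c$, $F=\bigcap_{n\in\mathbb N}\phi_F^{-1}[Y\setminus B_n]$; (ii) if $F_1,F_2\in\tau^c$ and $F_1\subset F_2$, then $\phi_{F_1}(x)\subset\phi_{F_2}(x)$ for all $x\in X$; (iii) for each $x\in X$ and $F\in\tau^c$ with $x\notin F$, $\phi_x$ is bounded on $F$; (iv) for each $F\in\tau^c$, $\phi_F$ is locally bounded on $X\setminus F$; (v) for each $F\in\tau^c$ and $K\in\mathcal C_X$ with $F\cap K=\emptyset$, $\phi_F$ is bounded on $K$. The following are equivalent. (a) $X$ is a Nagata-space. (b) There exists a map $\phi:\tau^c\to\mathcal L(X,\mathcal F(Y))$ satisfying (i), (ii), (iii) and (iv). (c) There exists a map $\phi:\tau^c\to\mathcal L(X,\mathcal F(Y))$ satisfying (i), (ii), (iii) and (v).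
   Context: $\mathbb N$ is the set of positive integers. A sequence $\{B_n\}_{n\in\mathbb N}$ of closed subsets of a space $Y$ is a strictly increasing closed cover of $Y$ if $Y=\bigcup_{n}B_n$, $B_1\neq\emptyset$ and $B_n\subsetneq B_{n+1}$ for each $n$. $\mathcal F(Y)$ is the family of nonempty closed subsets of $Y$. For a set-valued map $\psi:X\to\mathcal F(Y)$ and $B\subset Y$, $\psi^{-1}[B]=\{x\in X:\psi(x)\cap B\neq\emptyset\}$ and $\psi^{\#}[B]=\{x\in X:\psi(x)\subset B\}$. $\psi$ is lower semi-continuous if $\psi^{-1}[V]$ is open in $X$ for each open $V\subset Y$; $\mathcal L(X,\mathcal F(Y))$ is the set of all lower semi-continuous maps $X\to\mathcal F(Y)$. $\psi$ is bounded on $A\subset X$ if $A\subset\psi^{\#}[B_n]$ for some $n\in\mathbb N$; $\psi$ is locally bounded at $x\in X$ if there is a neighborhood $O$ of $x$ such that $\psi$ is bounded on $O$; $\psi$ is locally bounded on $A\subset X$ if it is locally bounded at each $x\in A$. A $g$-function for a space $X$ with topology $\tau$ is a map $g:\mathbb N\times X\to\tau$ such that $x\in g(n,x)$ and $g(n+1,x)\subset g(n,x)$ for all $x\in X$, $n\in\mathbb N$. A space $X$ is a Nagata-space if there is a $g$-function $g$ for $X$ such that whenever $g(n,x)\cap g(n,x_n)\neq\emptyset$ for all $n\in\mathbb N$, the point $x$ is a cluster point of the sequence $\langle x_n\rangle$. *)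

(* Defs.v *)
From mathcomp Require Import all_boot all_order all_algebra.
From mathcomp Require Import all_classical all_reals all_analysis.

Set Implicit Arguments.
Unset Strict Implicit.
Unset Printing Implicit Defensive.

Local Open Scope classical_set_scope.

(* Sequences indexed by the positive integers are indexed here by [nat],
   the index [n] standing for [n + 1]; in particular [B 0] is B_1. *)

Definition strictly_increasing_closed_cover (Y : topologicalType)
    (B : nat -> set Y) : Prop :=
  [/\ forall n, closed (B n),
      \bigcup_n B n = setT,
      B 0%N !=set0 &
      forall n, B n `<` B n.+1].

(* psi^{-1}[B] *)
Definition lower_inverse (X Y : Type) (psi : X -> set Y) (B : set Y) : set X :=
  [set x | psi x `&` B !=set0].

(* psi^{#}[B] *)
Definition upper_inverse (X Y : Type) (psi : X -> set Y) (B : set Y) : set X :=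
  [set x | psi x `<=` B].

(* The set L(X, F(Y)) of lower semi-continuous maps with nonempty closed
   values. *)
Definition lsc_maps (X Y : topologicalType) : set (X -> set Y) :=
  [set psi | [/\ forall x, closed (psi x),
                 forall x, psi x !=set0 &
                 forall V : set Y, open V -> open (lower_inverse psi V)]].

Definition sv_bounded_on (X Y : Type) (B : nat -> set Y) (psi : X -> set Y)
    (A : set X) : Prop :=
  exists n, A `<=` upper_inverse psi (B n).

Definition sv_locally_bounded_at (X : topologicalType) (Y : Type)
    (B : nat -> set Y) (psi : X -> set Y) (x : X) : Prop :=
  exists2 O : set X, nbhs x O & sv_bounded_on B psi O.

Definition sv_locally_bounded_on (X : topologicalType) (Y : Type)
    (B : nat -> set Y) (psi : X -> set Y) (A : set X) : Prop :=
  forall x, A x -> sv_locally_bounded_at B psi x.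

Definition g_function (X : topologicalType) (g : nat -> X -> set X) : Prop :=
  [/\ forall n x, open (g n x),
      forall n x, g n x x &
      forall n x, g n.+1 x `<=` g n x].

Definition nagata_space (X : topologicalType) : Prop :=
  exists2 g : nat -> X -> set X, g_function g &
    forall (x : X) (u : nat -> X),
      (forall n, g n x `&` g n (u n) !=set0) -> cluster (u @ \oo) x.

(* A map from the closed subsets of X to L(X, F(Y)) is represented by a
   function on all subsets of X, of which only the values at closed sets are
   constrained or used. *)
Definition closed_to_lsc (X Y : topologicalType)
    (phi : set X -> X -> set Y) : Prop :=
  forall F, closed F -> lsc_maps (phi F).

Definition prop_i (X Y : topologicalType) (B : nat -> set Y)
    (phi : set X -> X -> set Y) : Prop :=
  forall F, closed F -> F = \bigcap_n lower_inverse (phi F) (~` B n).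

Definition prop_ii (X Y : topologicalType)
    (phi : set X -> X -> set Y) : Prop :=
  forall F1 F2, closed F1 -> closed F2 -> F1 `<=` F2 ->
    forall x, phi F1 x `<=` phi F2 x.

Definition prop_iii (X Y : topologicalType) (B : nat -> set Y)
    (phi : set X -> X -> set Y) : Prop :=
  forall (x : X) F, closed F -> ~ F x -> sv_bounded_on B (phi [set x]) F.

Definition prop_iv (X Y : topologicalType) (B : nat -> set Y)
    (phi : set X -> X -> set Y) : Prop :=
  forall F, closed F -> sv_locally_bounded_on B (phi F) (~` F).

Definition prop_v (X Y : topologicalType) (B : nat -> set Y)
    (phi : set X -> X -> set Y) : Prop :=
  forall F K, closed F -> compact K -> F `&` K = set0 ->
    sv_bounded_on B (phi F) K.

(* Main.v *)
Require Import Defs.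
From mathcomp Require Import all_boot all_order all_algebra.
From mathcomp Require Import all_classical all_reals all_analysis.

(** A Nagata-space [X] with g-function [g] assigns to each set [F] the decreasing
    open neighbourhoods [U_n(F)], the union of the [g n x] for [x] in [F].
    The Nagata condition makes the closures of the [U_n(F)] intersect in [F]
    when [F] is closed ([nagata_separation]).  Letting [phi F] take the value
    [B k] at the points that leave the chain [U_n(F)] at stage [k], and the value
    [Y] at the points that never leave, gives a lower semi-continuous map whose
    values escape every [B n] precisely on [F] ([staircase]).  A point off [F] has
    a neighbourhood missing some [U_n(F)], which is local boundedness off [F]; for
    a singleton, [U_n({x})] is [g n x], and a closed set missing [x] misses some
    [g n x], which is boundedness of [phi [set x]] on that closed set.

    Local boundedness implies boundedness on compact sets because [B] is
    increasing ([sv_locally_bounded_compact]), so [prop_iv] implies [prop_v], and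
    it remains to recover [g] from [prop_v] ([maps_nagata]).  Take [g n x] to be
    the set where [phi [set x]] is not contained in [B n].  If [p n] lies in both
    [g n x] and [g n (u n)] for all [n], then [prop_iii] forces [p] to converge to
    [x].  Were [x] not a cluster point of [u], a tail of [u] would lie in a closed
    set [F] missing [x], and by monotonicity [phi F (p n)] would escape [B n] for
    all large [n]; but a tail of [p] together with [x] is a compact set missing
    [F], on which [prop_v] bounds [phi F]. *)

Set Implicit Arguments.
Unset Strict Implicit.
Unset Printing Implicit Defensive.

Local Open Scope classical_set_scope.

(** * Strictly increasing covers and boundedness *)

Section Cover.
Variables (Y : topologicalType) (B : nat -> set Y).
Hypothesis hB : strictly_increasing_closed_cover B.

Lemma cover_subset m n : (m <= n)%N -> B m `<=` B n.
Proof.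
have [_ _ _ lt_B] := hB.
elim: n => [|n IHn]; first by rewrite leqn0 => /eqP->.
rewrite leq_eqVlt => /predU1P[->//|/IHn]; have [? _] := lt_B n.
by move=> /subset_trans; apply.
Qed.

Lemma cover_neq_setT n : exists y, ~ B n y.
Proof.
have [_ _ _ /(_ n)[_ /existsNP[y /not_implyP[_ nBy]]]] := hB.
by exists y.
Qed.

(** Compactness makes the index of the bound uniform, since a local bound [B m]
    remains one when [m] is enlarged. *)
Lemma sv_locally_bounded_compact (X : topologicalType) (psi : X -> set Y)
    (K : set X) :
  compact K -> sv_locally_bounded_on B psi K -> sv_bounded_on B psi K.
Proof.
move=> /compact_near_coveringP cK bK.
have [|N _ KN] := cK nat \oo (fun n x => psi x `<=` B n).
  move=> x /bK[W Wx [m Wm]].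
  exists (W, [set n | (m <= n)%N]).
    by split => //; exists m.
  move=> [z n] /= [Wz le_mn].
  by apply: subset_trans (cover_subset le_mn); apply: Wm.
by exists N; apply: KN => /=.
Qed.

End Cover.

(** * From a decreasing chain of open sets to a lower semi-continuous map *)

(** For a decreasing chain [U], the value is [B k] at a point whose first missed
    stage is [k], and the whole space at a point of all [U n].  Writing it as a
    union over the stages reached makes lower semi-continuity immediate: the
    points whose value meets [V] form a union of sets [U n]. *)
Definition staircase (X Y : Type) (B : nat -> set Y) (U : nat -> set X)
    (x : X) : set Y :=
  [set y | B 0%N y \/ exists2 n, U n x & B n.+1 y].

Section Staircase.
Variables (X Y : topologicalType) (B : nat -> set Y) (U : nat -> set X).
Hypothesis hB : strictly_increasing_closed_cover B.
Hypothesis U_decr : forall n, U n.+1 `<=` U n.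

Lemma chain_subset m n : (m <= n)%N -> U n `<=` U m.
Proof.
elim: n => [|n IHn]; first by rewrite leqn0 => /eqP->.
rewrite leq_eqVlt => /predU1P[->//|/IHn].
exact: subset_trans.
Qed.

Lemma staircase_full x : (forall n, U n x) -> staircase B U x = setT.
Proof.
move=> Ux; apply/seteqP; split=> // y _.
have [_ Bcover _ _] := hB.
have [n _ Bny] : (\bigcup_n B n) y by rewrite Bcover.
by right; exists n => //; apply: (cover_subset hB _ Bny).
Qed.

Lemma staircase_bounded k x : ~ U k x -> staircase B U x `<=` B k.
Proof.
move=> nUx y [B0y|[n Unx Bny]]; first exact: (cover_subset hB _ B0y).
apply: (cover_subset hB _ Bny); rewrite ltnNge; apply/negP => le_kn.
exact: nUx (chain_subset le_kn Unx).
Qed.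

Lemma staircase_closed x : closed (staircase B U x).
Proof.
have [clB _ _ _] := hB.
have [Ux|/existsNP exU] := pselect (forall n, U n x).
  by rewrite staircase_full//; exact: closedT.
have exUb : exists n, `[< ~ U n x >] by have [n ?] := exU; exists n; apply/asboolP.
(* the value is [B k] for the first stage [k] that [x] does not reach *)
have [k /asboolP nUk kmin] := ex_minnP exUb.
suff -> : staircase B U x = B k by exact: clB.
apply/seteqP; split; first exact: staircase_bounded.
case: k kmin {nUk} => [|k] kmin y Bky; first by left.
right; exists k => //; apply: contrapT => /asboolP /kmin.
by rewrite ltnn.
Qed.

Lemma staircase_lsc : (forall n, open (U n)) -> lsc_maps (staircase B U).
Proof.
move=> oU; have [_ _ [y0 By0] _] := hB; split; first exact: staircase_closed.
  by move=> x; exists y0; left.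
move=> V _.
have [[y [B0y Vy]]|nV] := pselect (B 0%N `&` V !=set0).
  suff -> : lower_inverse (staircase B U) V = setT by exact: openT.
  by apply/seteqP; split => // x _; exists y; split => //; left.
suff -> : lower_inverse (staircase B U) V =
    \bigcup_(n in [set n | B n.+1 `&` V !=set0]) U n by exact: bigcup_open.
apply/seteqP; split => [x [y [[B0y|[n Unx Bny]] Vy]]|x [n [y [Bny Vy]] Unx]].
- by case: nV; exists y.
- by exists n => //; exists y.
- by exists y; split => //; right; exists n.
Qed.

End Staircase.

(** * Consequences of the Nagata condition *)

Definition g_expansion (X : Type) (g : nat -> X -> set X) (F : set X)
    (n : nat) : set X := \bigcup_(x in F) g n x.

(** Otherwise each [g n x] meets some [g n (u n)] with [u n] in [F], so [x] is a
    cluster point of a sequence in [F] and lies in [F]. *)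
Lemma nagata_separation (X : topologicalType) (g : nat -> X -> set X)
    (F : set X) (x : X) :
    (forall (x : X) (u : nat -> X),
      (forall n, g n x `&` g n (u n) !=set0) -> cluster (u @ \oo) x) ->
    closed F -> ~ F x ->
  exists n, g n x `&` g_expansion g F n = set0.
Proof.
move=> gN clF nFx; apply: contrapT => /forallNP meet; apply: nFx.
have /choice[u uP] : forall n, exists z, F z /\ g n x `&` g n z !=set0.
  move=> n; have /eqP/set0P[y [gxy [z Fz gzy]]] := meet n.
  by exists z; split => //; exists y.
apply: clF => O Ox.
apply: (gN x u (fun n => (uP n).2) F O) => //.
by exists 0%N => // n _; exact: (uP n).1.
Qed.

Lemma nagata_maps (X Y : topologicalType) (B : nat -> set Y) :
    strictly_increasing_closed_cover B -> nagata_space X ->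
  exists phi : set X -> X -> set Y,
    [/\ closed_to_lsc phi, prop_i B phi, prop_ii phi, prop_iii B phi
      & prop_iv B phi].
Proof.
move=> hB [g [g_open g_self g_decr] gN].
have decr F n : g_expansion g F n.+1 `<=` g_expansion g F n.
  by move=> x [z Fz /g_decr]; exists z.
have sep F x := @nagata_separation X g F x gN.
exists (fun F => staircase B (g_expansion g F)); split.
- move=> F _; apply: staircase_lsc => // n.
  by apply: bigcup_open => x _; exact: g_open.
- move=> F clF; apply/seteqP; split => [x Fx n _|x unb].
    have [y nBy] := cover_neq_setT hB n; exists y; split => //.
    by rewrite staircase_full// => k; exists x.
  apply: contrapT => /(sep _ _ clF)[n disj].
  have [//|y [phiy nBy]] := unb n; apply: nBy; apply: staircase_bounded phiy => //.
  by move=> Ux; have : (g n x `&` g_expansion g F n) x by []; rewrite disj.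
- move=> F1 F2 _ _ F12 x y [|[n [z /F12 F2z gzx] Bny]]; first by left.
  by right; exists n => //; exists z.
- move=> x F clF /(sep _ _ clF)[n disj]; exists n => z Fz.
  apply: staircase_bounded => // -[_ -> gxz].
  have : (g n x `&` g_expansion g F n) z by split => //; exists z.
  by rewrite disj.
- move=> F clF x /(sep _ _ clF)[n disj]; exists (g n x).
    by apply: open_nbhs_nbhs; split.
  exists n => z gxz; apply: staircase_bounded => // Uz.
  by have : (g n x `&` g_expansion g F n) z by []; rewrite disj.
Qed.

(** * Recovering the g-function *)

(** A filter containing this set and not clustering at [x] contains a set missing
    a neighbourhood of [x]; it therefore lives on finitely many terms of the
    sequence, and finite sets are compact. *)
Lemma compact_cvg_range (X : topologicalType) (p : nat -> X) (x : X) :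
  p @ \oo --> x -> compact (x |` range p).
Proof.
move=> px F FF FK; apply: contrapT => /set0P/negP/negPn/eqP noclus.
have nclus z : (x |` range p) z -> ~ cluster F z.
  move=> Kz Fz; have : ((x |` range p) `&` cluster F) z by [].
  by rewrite noclus.
have /existsNP[A /existsNP[W /not_implyP[FA /not_implyP[Wx AW]]]] :
  ~ cluster F x by apply: nclus; left.
have [m _ pW] := px W Wx.
have Ffin : F (p @` `I_m).
  apply: filterS (filterI FK FA) => z [[->|[n _ <-]] Az].
    by case: AW; exists x; split => //; exact: nbhs_singleton.
  exists n => //=; rewrite ltnNge; apply/negP => le_mn.
  by apply: AW; exists (p n); split => //; exact: pW.
have finK : finite_set (p @` `I_m) by apply: finite_image; exact: finite_II.
have [z [[n _ <-] clz]] := finite_compact finK FF Ffin.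
by apply: nclus clz; right; exists n.
Qed.

Lemma maps_nagata (X Y : topologicalType) (B : nat -> set Y)
    (phi : set X -> X -> set Y) :
    hausdorff_space X -> strictly_increasing_closed_cover B ->
    closed_to_lsc phi -> prop_i B phi -> prop_ii phi -> prop_iii B phi ->
    prop_v B phi ->
  nagata_space X.
Proof.
move=> hX hB lsc_phi phi_i phi_ii phi_iii phi_v.
have [clB _ _ _] := hB.
have cl1 (x : X) : closed [set x].
  exact/accessible_closed_set1/hausdorff_accessible.
exists (fun n x => lower_inverse (phi [set x]) (~` B n)).
  split=> [n x|n x|n x z [y [phiy nBy]]].
  - by have [_ _ ] := lsc_phi _ (cl1 x); apply; exact: closed_openC.
  - suff : (\bigcap_k lower_inverse (phi [set x]) (~` B k)) x by apply.
    by rewrite -(phi_i _ (cl1 x)).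
  - by exists y; split => // /(cover_subset hB (leqnSn n)).
move=> x u /choice[p pP].
have px : p @ \oo --> x.
  move=> O; rewrite nbhsE => -[V [oV Vx] VO].
  have [||m bm] := phi_iii x (~` V); [exact: open_closedC|by apply|].
  exists m => // n /= le_mn; apply: VO; apply: contrapT => nVp.
  have [[y [phiy nBy]] _] := pP n.
  by apply: nBy; apply: (cover_subset hB le_mn); exact: bm nVp _ phiy.
move=> A O [N _ uA]; rewrite nbhsE => -[V [oV Vx] VO].
apply: contrapT => AO.
have uV n : (N <= n)%N -> (~` V) (u n).
  by move=> le_Nn Vu; apply: AO; exists (u n); split; [exact: uA|exact: VO].
have [M _ pV] := px V (open_nbhs_nbhs (conj oV Vx)).
pose q n := p (n + M)%N.
have qx : q @ \oo --> x.
  move=> W /px[k _ pW]; exists k => // i /= le_ki.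
  by apply: pW; apply: leq_trans le_ki (leq_addr _ _).
have clF : closed (~` V) by exact: open_closedC.
have FK0 : ~` V `&` (x |` range q) = set0.
  apply/seteqP; split => // z [nVz [zx|[n _ zq]]]; apply: nVz.
    by rewrite zx.
  by rewrite -zq; apply: pV => /=; rewrite leq_addl.
have [m bm] := phi_v _ _ clF (compact_cvg_range qx) FK0.
(* an index beyond [N], where [u] lies outside [V], beyond the bound [m], and in
   the tail of [p] enumerated by [q] *)
pose n := (N + m + M)%N.
have [_ [y [phiy nBy]]] := pP n.
apply: nBy; apply: (@cover_subset _ _ hB m); first by rewrite /n addnAC leq_addl.
apply: (bm (p n)); first by right; exists (N + m)%N.
apply: phi_ii phiy => // z ->; apply: uV.
by rewrite /n -addnA leq_addr.
Qed.

Theorem theorem4p5 (X Y : topologicalType) (hX : hausdorff_space X)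
    (hY : hausdorff_space Y) (B : nat -> set Y)
    (hB : strictly_increasing_closed_cover B) :
  (nagata_space X <->
   exists phi : set X -> X -> set Y,
     [/\ closed_to_lsc phi, prop_i B phi, prop_ii phi, prop_iii B phi
       & prop_iv B phi]) /\
  (nagata_space X <->
   exists phi : set X -> X -> set Y,
     [/\ closed_to_lsc phi, prop_i B phi, prop_ii phi, prop_iii B phi
       & prop_v B phi]).
Proof.
have iv_v (phi : set X -> X -> set Y) : prop_iv B phi -> prop_v B phi.
  move=> phi_iv F K clF cK FK0; apply: sv_locally_bounded_compact => // x Kx.
  apply: phi_iv => // Fx.
  by have : (F `&` K) x by []; rewrite FK0.
split; split.
- exact: nagata_maps.
- by move=> [phi [? ? ? ? /iv_v]]; exact: maps_nagata.
- by move=> /(nagata_maps hB)[phi [? ? ? ? /iv_v]]; exists phi.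
- by move=> [phi [? ? ? ?]]; exact: maps_nagata.
Qed.
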